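(* Let $\mathcal L$ be a FOLeq algebra over a termlike $\sigma$-algebra $\mathsf U$ and let $\mathcal I$ be an interpretation of a signature $(\Sigma,\Pi,\mathrm{ar})$ over $\mathcal L$. If the sequent $\Phi\vdash\Psi$ is derivable, then $\bigwedge\{[\![\phi]\!]\mid \phi\in\Phi\}\leq\bigvee\{[\![\psi]\!]\mid\psi\in\Psi\}$ in $\mathcal L$.
   Context: Nominal sets: fix a countably infinite set $\mathbb A$ of atoms; $a,b,c$ denote distinct atoms. A permutation is a bijection $\pi$ of $\mathbb A$ moving finitely many atoms; $(a\ b)$ is the swapping. A set with a permutation action is a set with a group action $\pi\cdot x$ of permutations; $A\subseteq\mathbb A$ supports $x$ if $\pi\cdot x=x$ whenever $\pi$ fixes $A$ pointwise; a nominal set is one where every element has a finite supporting set, and $\mathrm{supp}(x)$ is the least such; $a\#x$ means $a\notin\mathrm{supp}(x)$. A map is equivariant if $\pi\cdot f(x)=f(\pi\cdot x)$. $\mathbb A$ carries $\pi\cdot a=\pi(a)$; products act pointwise. $\mathsf N a.\,\Phi(a)$ means $\{a\mid\neg\Phi(a)\}$ is finite. Termlike $\sigma$-algebra $\mathsf U$: a nominal set with equivariant $(x,a,u)\mapsto x[a:=u]$ ($\mathsf U\times\mathbb A\times\mathsf U\to\mathsf U$) and an equivariant injection $\mathrm{atm}:\mathbb A\to\mathsf U$ (written $a$), satisfying: $a[a:=x]=x$; $x[a:=a]=x$; $a\#x\Rightarrow x[a:=u]=x$; $b\#x\Rightarrow x[a:=u]=((b\ a)\cdot x)[b:=u]$;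 $a\#v\Rightarrow x[a:=u][b:=v]=x[b:=v][a:=u[b:=v]]$. A $\sigma$-algebra over $\mathsf U$ is a nominal set $X$ with equivariant $X\times\mathbb A\times\mathsf U\to X$, $x[a:=u]$, satisfying the last four axioms (with $x\in X$, $u,v\in\mathsf U$). Simultaneous substitution: $x[a_1:=u_1,\dots,a_n:=u_n]=(((a_1'\ a_1)\circ\cdots\circ(a_n'\ a_n))\cdot x)[a_1':=u_1]\cdots[a_n':=u_n]$ for fresh distinct $a_i'$. Nominal poset: nominal set with equivariant partial order $\leq$. For finite $X\subseteq\mathcal L$, finite $A\subseteq\mathbb A$, the $A\#$limit $\bigwedge^{\#A}X$ is the greatest element of $\{x'\mid A\cap\mathrm{supp}(x')=\emptyset,\ x'\leq x\ \forall x\in X\}$; $A\#$colimit $\bigvee^{\#A}X$ dually (least $A$-fresh upper bound). Finitely fresh-(co)complete: all these exist. $\top,\bot,x\wedge y,x\vee y$ are the ordinary (co)limits of $\emptyset,\{x,y\}$; $\bigwedge^{\#a}x=\bigwedge^{\#\{a\}}\{x\}$. Complemented: every $x$ has $\neg x$ with $x\wedge\neg x=\bot$, $x\vee\neg x=\top$. Distributive: $x\vee(y\wedge z)=(x\vee y)\wedge(x\vee z)$ and $a\#x\Rightarrow x\vee\bigwedge^{\#a}y=\bigwedge^{\#a}(x\vee y)$. A $\sigma$-algebra structure over $\mathsf U$ on $\mathcal L$ is compatible if, whenever $A\cap(\mathrm{supp}(u)\cup\{a\})=\emptyset$, $(\bigwedge^{\#A}X)[a:=u]=\bigwedge^{\#A}\{x[a:=u]\mid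 x\in X\}$ and likewise for $\bigvee^{\#A}$, and $(\neg x)[a:=u]=\neg(x[a:=u])$. An equality is an element $(a=^{\mathcal L}b)$ with support in $\{a,b\}$ such that $(a=^{\mathcal L}b)[a:=u,b:=u]=\top$ and $(a=^{\mathcal L}b)[a:=u,b:=v]\wedge z[a:=u]=(a=^{\mathcal L}b)[a:=u,b:=v]\wedge z[a:=v]$ for all $u,v\in\mathsf U$, $z\in\mathcal L$. A FOLeq algebra over $\mathsf U$ is a finitely fresh-complete and fresh-cocomplete, distributive, complemented nominal poset with a compatible $\sigma$-algebra structure over $\mathsf U$ and an equality. Syntax: a signature gives function symbols $\mathsf f$ and predicate symbols $\mathsf P$ with arities. Terms $r::=a\mid \mathsf f(r_1,\dots,r_n)$; predicates $\phi::=\bot\mid r=r\mid\mathsf P(r_1,\dots,r_n)\mid\phi\wedge\phi\mid\neg\phi\mid\forall a.\phi$, taken up to $\alpha$-equivalence with capture-avoiding substitution; $\phi\vee\psi$ abbreviates $\neg(\neg\phi\wedge\neg\psi)$. Derivable sequents $\Phi\vdash\Psi$ (finite sets) are generated by the classical sequent rules: Hyp ($\Phi,\phi\vdash\phi,\Psi$), $\bot$L, $\wedge$L, $\wedge$R, $\neg$L, $\neg$R; $\forall$L: from $\Phi,\phi[a:=r]\vdash\Psi$ infer $\Phi,\forall a.\phi\vdash\Psi$; $\forall$R: from $\Phi\vdash\psi,\Psi$ with $a$ not free in $\Phi,\Psi$ infer $\Phi\vdash\forall a.\psi,\Psi$; $=$R: from $\Phi,r=r\vdash\Psi$ infer $\Phi\vdash\Psi$;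 $=$L: from $\Phi,r'=r,\phi[a:=r']\vdash\Psi$ infer $\Phi,r'=r,\phi[a:=r]\vdash\Psi$. Interpretation: assigns to each $n$-ary $\mathsf f$ an equivariant map $\mathsf f^{\mathcal I}$ from $n$-tuples of distinct atoms to $\mathsf U$, and to each $n$-ary $\mathsf P$ an equivariant map $\mathsf P^{\mathcal I}$ from $n$-tuples of distinct atoms to $\mathcal L$; extended by $\mathsf f^{\mathcal I}(u_1,..,u_n)=\mathsf f^{\mathcal I}(a_1,..,a_n)[a_1:=u_1,..,a_n:=u_n]$ (fresh $a_i$), likewise $\mathsf P^{\mathcal I}$, and $u_1=^{\mathcal I}u_2=(a=^{\mathcal L}b)[a:=u_1,b:=u_2]$. Then $[\![a]\!]=\mathrm{atm}(a)$, $[\![\mathsf f(\vec r)]\!]=\mathsf f^{\mathcal I}([\![\vec r]\!])$, $[\![\bot]\!]=\bot$, $[\![r=s]\!]=[\![r]\!]=^{\mathcal I}[\![s]\!]$, $[\![\mathsf P(\vec r)]\!]=\mathsf P^{\mathcal I}([\![\vec r]\!])$, $[\![\phi\wedge\psi]\!]=[\![\phi]\!]\wedge[\![\psi]\!]$, $[\![\neg\phi]\!]=\neg[\![\phi]\!]$, $[\![\forall a.\phi]\!]=\bigwedge^{\#a}[\![\phi]\!]$. *)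

(* Defs.v *)
From HB Require Import structures.
From mathcomp Require Import all_boot all_order.
From mathcomp Require Import finmap.
From mathcomp Require Import generic_quotient boolp classical_sets cardinality.

Set Implicit Arguments.
Unset Strict Implicit.
Unset Printing Implicit Defensive.

Local Open Scope fset_scope.

HB.mixin Record IsInfinite A of Countable A := {
  fresh_exists : forall B : {fset A}, exists a : A, a \notin B
}.
#[short(type="atomType")]
HB.structure Definition Atom := {A of Countable A & IsInfinite A}.

Record fperm (A : atomType) := FPerm {
  fperm_fun :> A -> A;
  fperm_bij : bijective fperm_fun;
  fperm_fin : exists B : {fset A}, forall a, a \notin B -> fperm_fun a = a
}.

Section Permutations.
Variable A : atomType.
Implicit Types (p q : fperm A) (a b : A).

Lemma fperm_id_fin : exists B : {fset A}, forall a, a \notin B -> id a = a.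
Proof. by exists fset0. Qed.

Definition fperm_id : fperm A := FPerm (inv_bij (fun _ => erefl)) fperm_id_fin.

Lemma fperm_comp_fin p q :
  exists B : {fset A}, forall a, a \notin B -> (p \o q) a = a.
Proof.
have [B hB] := fperm_fin p; have [C hC] := fperm_fin q.
exists (B `|` C) => a; rewrite inE negb_or => /andP[aB aC] /=.
by rewrite hC // hB.
Qed.

Definition fperm_comp p q : fperm A :=
  FPerm (bij_comp (fperm_bij p) (fperm_bij q)) (fperm_comp_fin p q).

Definition swap_fun a b : A -> A := [fun c => c with a |-> b, b |-> a].

Lemma swap_funK a b : involutive (swap_fun a b).
Proof.
move=> c; rewrite /swap_fun /=.
case: (eqVneq c a) => [->|ca]; first by rewrite eqxx; case: eqVneq.
case: (eqVneq c b) => [->|cb]; first by rewrite eqxx.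
by rewrite (negPf ca) (negPf cb).
Qed.

Lemma swap_fin a b :
  exists B : {fset A}, forall c, c \notin B -> swap_fun a b c = c.
Proof.
exists [fset a; b] => c; rewrite !inE negb_or => /andP[ca cb].
by rewrite /swap_fun /= (negPf ca) (negPf cb).
Qed.

Definition swap a b : fperm A := FPerm (inv_bij (@swap_funK a b)) (swap_fin a b).

Definition fresh_atom (B : {fset A}) : A := xchoose (fresh_exists B).

Fixpoint fresh_atoms (n : nat) (B : {fset A}) : seq A :=
  if n is m.+1
  then let a := fresh_atom B in a :: fresh_atoms m (a |` B)
  else [::].

Lemma fresh_atomP B : fresh_atom B \notin B.
Proof. exact: (xchooseP (fresh_exists B)). Qed.

Lemma size_fresh_atoms n B : size (fresh_atoms n B) == n.
Proof. by elim: n B => //= n IH B; rewrite eqSS. Qed.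

Lemma fresh_atoms_notin n B a : a \in fresh_atoms n B -> a \notin B.
Proof.
elim: n B => //= n IH B; rewrite inE => /orP[/eqP->|/IH].
  exact: fresh_atomP.
by rewrite inE negb_or => /andP[].
Qed.

Lemma fresh_atoms_uniq n B : uniq (fresh_atoms n B).
Proof.
elim: n B => //= n IH B; rewrite IH andbT; apply/negP => /fresh_atoms_notin.
by rewrite !inE eqxx.
Qed.

End Permutations.
Arguments fperm_id {A}.

Section DistinctTuples.
Variables (A : atomType) (n : nat).

Definition dtuple := {t : n.-tuple A | uniq t}.

Lemma map_dtuple_uniq (p : fperm A) (t : dtuple) : uniq (map_tuple p (val t)).
Proof. by rewrite map_inj_uniq ?(valP t)//; apply: bij_inj (fperm_bij p). Qed.

Definition dtuple_act (p : fperm A) (t : dtuple) : dtuple :=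
  exist _ (map_tuple p (val t)) (map_dtuple_uniq p t).

Definition fresh_dtuple (B : {fset A}) : dtuple :=
  exist _ (Tuple (size_fresh_atoms n B)) (fresh_atoms_uniq n B).

End DistinctTuples.

HB.mixin Record HasPermAction (A : atomType) X := {
  act : fperm A -> X -> X;
  act_id : forall x, act fperm_id x = x;
  act_comp : forall p q x, act (fperm_comp p q) x = act p (act q x)
}.
#[short(type="permSetType")]
HB.structure Definition PermSet A := {X of HasPermAction A X & Choice X}.

Definition supports (A : atomType) (X : permSetType A) (B : {fset A}) (x : X) :=
  forall p : fperm A, (forall a, a \in B -> p a = a) -> act p x = x.

HB.mixin Record IsNominal (A : atomType) X of PermSet A X := {
  finitely_supported : forall x : X, exists B : {fset A}, supports B x
}.
#[short(type="nominalType")]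
HB.structure Definition Nominal A := {X of IsNominal A X & PermSet A X}.

Section Support.
Variables (A : atomType) (X : nominalType A).

(* The set below is finite by [finitely_supported], so [fset_set] is faithful. *)
Definition supp (x : X) : {fset A} :=
  fset_set [set a | forall B : {fset A}, supports B x -> a \in B]%classic.

Lemma in_supp (x : X) a :
  (a \in supp x) <-> (forall B : {fset A}, supports B x -> a \in B).
Proof.
have [C hC] := finitely_supported x.
have fin : finite_set [set a | forall B : {fset A}, supports B x -> a \in B]%classic.
  by apply: (sub_finite_set _ (finite_fset C)) => b /= /(_ C hC).
by rewrite /supp in_fset_set // inE.
Qed.

End Support.
Notation "a # x" := (a \notin supp x) (at level 70, no associativity).

HB.mixin Record IsTermlike (A : atomType) U of Nominal A U := {
  atm : A -> U;
  tsub : U -> A -> U -> U;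
  atm_inj : injective atm;
  atm_equivariant : forall p a, act p (atm a) = atm (p a);
  tsub_equivariant : forall p x a u,
    act p (tsub x a u) = tsub (act p x) (p a) (act p u);
  tsub_atm : forall a x, tsub (atm a) a x = x;
  tsub_id : forall x a, tsub x a (atm a) = x;
  tsub_fresh : forall x a u, a # x -> tsub x a u = x;
  tsub_alpha : forall x a b u, a != b ->
    b # x -> tsub x a u = tsub (act (swap b a) x) b u;
  tsub_sub : forall x a b u v, a != b ->
    a # v -> tsub (tsub x a u) b v = tsub (tsub x b v) a (tsub u b v)
}.
#[short(type="termlikeType")]
HB.structure Definition Termlike A := {U of IsTermlike A U & Nominal A U}.

HB.mixin Record IsSigmaAlgebra (A : atomType) (U : termlikeType A) X
    of Nominal A X := {
  sub : X -> A -> U -> X;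
  sub_equivariant : forall p x a u,
    act p (sub x a u) = sub (act p x) (p a) (act p u);
  sub_id : forall x a, sub x a (atm a) = x;
  sub_fresh : forall x a u, a # x -> sub x a u = x;
  sub_alpha : forall x a b u, a != b ->
    b # x -> sub x a u = sub (act (swap b a) x) b u;
  sub_sub : forall x a b u v, a != b ->
    a # v -> sub (sub x a u) b v = sub (sub x b v) a (tsub u b v)
}.
#[short(type="sigmaType")]
HB.structure Definition SigmaAlgebra A U :=
  {X of IsSigmaAlgebra A U X & Nominal A X}.

(* Simultaneous substitution for an operation [sb]; it is used both with
   [tsub] and with [sub]. *)
Definition simsub (A : atomType) (X U : nominalType A) (sb : X -> A -> U -> X)
    (x : X) (s : seq (A * U)) : X :=
  let cs := fresh_atoms (size s)
              (supp x `|` \bigcup_(au <- s) (au.1 |` supp au.2)) in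
  let p := foldr (fun ca => fperm_comp (swap ca.1 ca.2)) fperm_id
             (zip cs (unzip1 s)) in
  foldl (fun y cu => sb y cu.1 cu.2) (act p x) (zip cs (unzip2 s)).

HB.mixin Record IsEquivariantOrder (d : Order.disp_t) (A : atomType) L
    of Nominal A L & Order.POrder d L := {
  le_equivariant : forall (p : fperm A) (x y : L),
    (x <= y)%O -> (act p x <= act p y)%O
}.
#[short(type="nominalPOrderType")]
HB.structure Definition NominalPOrder d A :=
  {L of IsEquivariantOrder d A L & Nominal A L & Order.POrder d L}.

Section FreshLimits.
Variables (d : Order.disp_t) (A : atomType) (L : nominalPOrderType d A).
Implicit Types (B : {fset A}) (X : {fset L}) (x : L).

Definition fresh_lb B X x : Prop :=
  [disjoint B & supp x] /\ forall y, y \in X -> (x <= y)%O.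

Definition fresh_ub B X x : Prop :=
  [disjoint B & supp x] /\ forall y, y \in X -> (y <= x)%O.

Definition is_fresh_lim B X x : Prop :=
  fresh_lb B X x /\ forall x', fresh_lb B X x' -> (x' <= x)%O.

Definition is_fresh_colim B X x : Prop :=
  fresh_ub B X x /\ forall x', fresh_ub B X x' -> (x <= x')%O.

End FreshLimits.

(* Fresh limits are unique by antisymmetry, so carrying them as operations is
   the same as requiring that they exist. *)
HB.mixin Record IsFreshComplete (d : Order.disp_t) (A : atomType) L
    of NominalPOrder d A L := {
  flim : {fset A} -> {fset L} -> L;
  fcolim : {fset A} -> {fset L} -> L;
  flimP : forall B X, is_fresh_lim B X (flim B X);
  fcolimP : forall B X, is_fresh_colim B X (fcolim B X)
}.
#[short(type="freshCompleteType")]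
HB.structure Definition FreshComplete d A :=
  {L of IsFreshComplete d A L & NominalPOrder d A L}.

Section LatticeOperations.
Variables (d : Order.disp_t) (A : atomType) (L : freshCompleteType d A).

Definition ftop : L := flim fset0 fset0.
Definition fbot : L := fcolim fset0 fset0.
Definition fmeet (x y : L) : L := flim fset0 [fset x; y].
Definition fjoin (x y : L) : L := fcolim fset0 [fset x; y].
Definition fall (a : A) (x : L) : L := flim [fset a] [fset x].

End LatticeOperations.
Arguments ftop {d A L}.
Arguments fbot {d A L}.

HB.mixin Record IsFOLeq (d : Order.disp_t) (A : atomType) (U : termlikeType A) L
    of FreshComplete d A L & SigmaAlgebra A U L := {
  compl : L -> L;
  fmeet_compl : forall x, fmeet x (compl x) = fbot;
  fjoin_compl : forall x, fjoin x (compl x) = ftop;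
  fjoin_meet : forall x y z : L,
    fjoin x (fmeet y z) = fmeet (fjoin x y) (fjoin x z);
  fjoin_fall : forall (x y : L) a,
    a # x -> fjoin x (fall a y) = fall a (fjoin x y);
  sub_flim : forall (B : {fset A}) (X : {fset L}) (a : A) (u : U),
    [disjoint B & a |` supp u] ->
    sub (flim B X) a u = flim B [fset sub x a u | x in X];
  sub_fcolim : forall (B : {fset A}) (X : {fset L}) (a : A) (u : U),
    [disjoint B & a |` supp u] ->
    sub (fcolim B X) a u = fcolim B [fset sub x a u | x in X];
  sub_compl : forall x a (u : U), sub (compl x) a u = compl (sub x a u);
  (* The equality is one element (a = b) for one pair of distinct atoms a, b;
     permuting it gives the element for any other pair. *)
  eq_atom1 : A;
  eq_atom2 : A;
  eq_elem : L;
  eq_atom_neq : eq_atom1 != eq_atom2;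
  supp_eq_elem : supp eq_elem `<=` [fset eq_atom1; eq_atom2];
  eq_elem_refl : forall u : U,
    simsub sub eq_elem [:: (eq_atom1, u); (eq_atom2, u)] = ftop;
  eq_elem_subst : forall (u v : U) (z : L),
    let e := simsub sub eq_elem [:: (eq_atom1, u); (eq_atom2, v)] in
    fmeet e (sub z eq_atom1 u) = fmeet e (sub z eq_atom1 v)
}.
#[short(type="folEqType")]
HB.structure Definition FOLeq d A U :=
  {L of IsFOLeq d A U L & FreshComplete d A L & SigmaAlgebra A U L}.
Arguments eq_atom1 {d A U} s.
Arguments eq_atom2 {d A U} s.
Arguments eq_elem {d A U} s.

Record signature := Signature {
  fsym : Type;
  psym : Type;
  far : fsym -> nat;
  par : psym -> nat
}.

Inductive term (A : atomType) (S : signature) :=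
| Var of A
| App (f : fsym S) of ('I_(far f) -> term A S).

Inductive rpred (A : atomType) (S : signature) :=
| RBot
| REq of term A S & term A S
| RRel (P : psym S) of ('I_(par P) -> term A S)
| RAnd of rpred A S & rpred A S
| RNot of rpred A S
| RAll of A & rpred A S.

Arguments Var {A S}.
Arguments App {A S}.
Arguments RBot {A S}.
Arguments RRel {A S}.

Section RawSyntax.
Variables (A : atomType) (S : signature).
Implicit Types (a b : A) (p : fperm A) (r t : term A S) (phi psi : rpred A S).

Fixpoint tfv t : {fset A} :=
  match t with
  | Var a => [fset a]
  | App f ts => \bigcup_(i <- enum 'I_(far f)) tfv (ts i)
  end.

Fixpoint tact p t : term A S :=
  match t with
  | Var a => Var (p a)
  | App f ts => App f (fun i => tact p (ts i))
  end.

Fixpoint tsubst t a r : term A S :=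
  match t with
  | Var b => if b == a then r else Var b
  | App f ts => App f (fun i => tsubst (ts i) a r)
  end.

Fixpoint rfv phi : {fset A} :=
  match phi with
  | RBot => fset0
  | REq r t => tfv r `|` tfv t
  | RRel P ts => \bigcup_(i <- enum 'I_(par P)) tfv (ts i)
  | RAnd phi psi => rfv phi `|` rfv psi
  | RNot phi => rfv phi
  | RAll a phi => rfv phi `\ a
  end.

Fixpoint ract p phi : rpred A S :=
  match phi with
  | RBot => RBot
  | REq r t => REq (tact p r) (tact p t)
  | RRel P ts => RRel P (fun i => tact p (ts i))
  | RAnd phi psi => RAnd (ract p phi) (ract p psi)
  | RNot phi => RNot (ract p phi)
  | RAll a phi => RAll (p a) (ract p phi)
  end.

Inductive alpha : rpred A S -> rpred A S -> Prop :=
| alpha_refl phi : alpha phi phi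
| alpha_sym phi psi : alpha phi psi -> alpha psi phi
| alpha_trans phi psi chi : alpha phi psi -> alpha psi chi -> alpha phi chi
| alpha_and phi phi' psi psi' :
    alpha phi phi' -> alpha psi psi' -> alpha (RAnd phi psi) (RAnd phi' psi')
| alpha_not phi phi' : alpha phi phi' -> alpha (RNot phi) (RNot phi')
| alpha_all a phi phi' : alpha phi phi' -> alpha (RAll a phi) (RAll a phi')
| alpha_rename a b phi :
    b \notin rfv phi -> alpha (RAll a phi) (RAll b (ract (swap b a) phi)).

(* Capture-avoiding substitution by structural recursion: [rsubst_act p phi a r]
   computes (p . phi)[a := r]; the permutation records the renamings of bound
   atoms made so far. *)
Fixpoint rsubst_act p phi a r : rpred A S :=
  match phi with
  | RBot => RBot
  | REq t t' => REq (tsubst (tact p t) a r) (tsubst (tact p t') a r)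
  | RRel P ts => RRel P (fun i => tsubst (tact p (ts i)) a r)
  | RAnd phi psi => RAnd (rsubst_act p phi a r) (rsubst_act p psi a r)
  | RNot phi => RNot (rsubst_act p phi a r)
  | RAll b phi =>
      let c := fresh_atom (a |` (tfv r `|` rfv (ract p phi))) in
      RAll c (rsubst_act (fperm_comp (swap c (p b)) p) phi a r)
  end.

Definition rsubst phi a r := rsubst_act fperm_id phi a r.

HB.instance Definition _ := gen_eqMixin (rpred A S).
HB.instance Definition _ := gen_choiceMixin (rpred A S).

Definition alphab : rel (rpred A S) := fun phi psi => `[< alpha phi psi >].

Lemma alphab_refl : reflexive alphab.
Proof. by move=> phi; apply/asboolP/alpha_refl. Qed.

Lemma alphab_sym : symmetric alphab.
Proof. by move=> phi psi; apply/asboolP/asboolP => /alpha_sym. Qed.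

Lemma alphab_trans : transitive alphab.
Proof.
move=> psi phi chi /asboolP h1 /asboolP h2.
by apply/asboolP; apply: alpha_trans h1 h2.
Qed.

Canonical alpha_equiv := EquivRel alphab alphab_refl alphab_sym alphab_trans.

Definition fpred : Type := {eq_quot alpha_equiv}%qT.
HB.instance Definition _ := Choice.on fpred.
HB.instance Definition _ := EqQuotient.on fpred.

End RawSyntax.

Section Predicates.
Variables (A : atomType) (S : signature).
Implicit Types (a b : A) (r t : term A S) (phi psi : fpred A S).
Implicit Types (Phi Psi : {fset fpred A S}).

Definition cls (phi : rpred A S) : fpred A S := (\pi_(fpred A S) phi)%qT.

Lemma cls_eqP (phi psi : rpred A S) : cls phi = cls psi <-> alpha phi psi.
Proof.
by split=> [/eqP|h]; [rewrite eqmodE => /asboolP|apply/eqP; rewrite eqmodE; apply/asboolP].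
Qed.

Definition PBot : fpred A S := cls RBot.
Definition PEq r t : fpred A S := cls (REq r t).
Definition PRel (P : psym S) (ts : 'I_(par P) -> term A S) : fpred A S :=
  cls (RRel P ts).
Definition PAnd phi psi : fpred A S := cls (RAnd (repr phi) (repr psi)).
Definition PNot phi : fpred A S := cls (RNot (repr phi)).
Definition PAll a phi : fpred A S := cls (RAll a (repr phi)).

(* Both operations respect alpha-equivalence, so the choice of representative
   is immaterial. *)
Definition pfv phi : {fset A} := rfv (repr phi).
Definition psubst phi a r : fpred A S := cls (rsubst (repr phi) a r).

Lemma alpha_repr (phi : rpred A S) : alpha (repr (cls phi)) phi.
Proof. by apply/cls_eqP; rewrite /cls reprK. Qed.

Lemma PAnd_cls (phi psi : rpred A S) : PAnd (cls phi) (cls psi) = cls (RAnd phi psi).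
Proof. by apply/cls_eqP/alpha_and; apply: alpha_repr. Qed.

Lemma PNot_cls (phi : rpred A S) : PNot (cls phi) = cls (RNot phi).
Proof. by apply/cls_eqP/alpha_not/alpha_repr. Qed.

Lemma PAll_cls a (phi : rpred A S) : PAll a (cls phi) = cls (RAll a phi).
Proof. by apply/cls_eqP/alpha_all/alpha_repr. Qed.

Definition not_free_in a Phi : Prop := forall phi, phi \in Phi -> a \notin pfv phi.

Inductive derivable : {fset fpred A S} -> {fset fpred A S} -> Prop :=
| d_hyp phi Phi Psi : derivable (phi |` Phi) (phi |` Psi)
| d_botL Phi Psi : derivable (PBot |` Phi) Psi
| d_andL phi psi Phi Psi :
    derivable (phi |` (psi |` Phi)) Psi ->
    derivable (PAnd phi psi |` Phi) Psi
| d_andR phi psi Phi Psi :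
    derivable Phi (phi |` Psi) -> derivable Phi (psi |` Psi) ->
    derivable Phi (PAnd phi psi |` Psi)
| d_notL phi Phi Psi :
    derivable Phi (phi |` Psi) -> derivable (PNot phi |` Phi) Psi
| d_notR phi Phi Psi :
    derivable (phi |` Phi) Psi -> derivable Phi (PNot phi |` Psi)
| d_allL a phi r Phi Psi :
    derivable (psubst phi a r |` Phi) Psi ->
    derivable (PAll a phi |` Phi) Psi
| d_allR a psi Phi Psi :
    not_free_in a Phi -> not_free_in a Psi ->
    derivable Phi (psi |` Psi) -> derivable Phi (PAll a psi |` Psi)
| d_eqR r Phi Psi :
    derivable (PEq r r |` Phi) Psi -> derivable Phi Psi
| d_eqL r' r a phi Phi Psi :
    derivable (PEq r' r |` (psubst phi a r' |` Phi)) Psi ->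
    derivable (PEq r' r |` (psubst phi a r |` Phi)) Psi.

End Predicates.

Record interpretation (d : Order.disp_t) (A : atomType) (U : termlikeType A)
    (L : folEqType d U) (S : signature) := Interpretation {
  fint : forall f : fsym S, dtuple A (far f) -> U;
  pint : forall P : psym S, dtuple A (par P) -> L;
  fint_equivariant : forall f p t, act p (@fint f t) = @fint f (dtuple_act p t);
  pint_equivariant : forall P p t, act p (@pint P t) = @pint P (dtuple_act p t)
}.
Arguments fint {d A U L S} _ f t.
Arguments pint {d A U L S} _ P t.

Section Denotation.
Variables (d : Order.disp_t) (A : atomType) (U : termlikeType A).
Variables (L : folEqType d U) (S : signature) (I : interpretation L S).

Definition fint_ext (f : fsym S) (us : 'I_(far f) -> U) : U :=
  let t := fresh_dtuple (far f) (\bigcup_(i <- enum 'I_(far f)) supp (us i)) in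
  simsub tsub (fint I f t) (zip (val t) [seq us i | i <- enum 'I_(far f)]).

Definition pint_ext (P : psym S) (us : 'I_(par P) -> U) : L :=
  let t := fresh_dtuple (par P) (\bigcup_(i <- enum 'I_(par P)) supp (us i)) in
  simsub sub (pint I P t) (zip (val t) [seq us i | i <- enum 'I_(par P)]).

Definition eq_ext (u v : U) : L :=
  simsub sub (eq_elem L) [:: (eq_atom1 L, u); (eq_atom2 L, v)].

Fixpoint tden (r : term A S) : U :=
  match r with
  | Var a => atm a
  | App f ts => fint_ext (fun i => tden (ts i))
  end.

Fixpoint rden (phi : rpred A S) : L :=
  match phi with
  | RBot => fbot
  | REq r t => eq_ext (tden r) (tden t)
  | RRel P ts => pint_ext (fun i => tden (ts i))
  | RAnd phi psi => fmeet (rden phi) (rden psi)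
  | RNot phi => compl (rden phi)
  | RAll a phi => fall a (rden phi)
  end.

(* [rden] is constant on alpha-equivalence classes, so the choice of
   representative is immaterial. *)
Definition den (phi : fpred A S) : L := rden (repr phi).

End Denotation.

(* Main.v *)
Require Import Defs.
From HB Require Import structures.
From mathcomp Require Import all_boot all_order finmap.
From mathcomp Require Import boolp.
Import Order.TTheory.
Local Open Scope fset_scope.

(** The denotation of raw predicates is equivariant, is supported by the free
    atoms, is invariant under alpha-equivalence, and turns syntactic
    substitution into the [sub] of the sigma-algebra; each rule then becomes an
    inequality in [L].  All four properties reduce to the same facts about
    simultaneous substitution: when the support of [x] lies in the distinct
    names [ns], any permutation [q] sending [ns] to atoms fresh for the terms
    [us] computes [simsub x ns us] as successive substitutions in [q . x],
    because two such choices differ by a permutation that fixes the supports of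
    [us], hence the result. *)

Set Implicit Arguments.
Unset Strict Implicit.
Unset Printing Implicit Defensive.

(** * Permutations and supports *)

Section FinitePermutations.
Variable A : atomType.
Implicit Types (p q : fperm A) (a b c : A) (B : {fset A}) (cs ns : seq A).

Lemma fperm_ext p q : p =1 q -> p = q.
Proof.
case: p => f fb ff; case: q => g gb gf /= /funext fg.
by case: g / fg gb gf => gb gf; congr FPerm; apply: Prop_irrelevance.
Qed.

Lemma fperm_inj p : injective p.
Proof. exact: bij_inj (fperm_bij p). Qed.

Lemma fperm_inverse p : exists q : fperm A, cancel p q /\ cancel q p.
Proof.
have [g pK gK] := fperm_bij p; have [B hB] := fperm_fin p.
have gfin : exists B : {fset A}, forall a, a \notin B -> g a = a.
  by exists B => a aB; rewrite -{1}(hB a aB) pK.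
by exists (FPerm (Bijective gK pK) gfin).
Qed.

Lemma swapL a b : swap a b a = b.
Proof. by rewrite /= /swap_fun /= eqxx. Qed.

Lemma swapR a b : swap a b b = a.
Proof. by rewrite /= /swap_fun /= eqxx; case: eqVneq. Qed.

Lemma swapN a b c : c != a -> c != b -> swap a b c = c.
Proof. by move=> /negPf ca /negPf cb; rewrite /= /swap_fun /= ca cb. Qed.

(** This is the renaming permutation that [simsub] builds inline. *)
Definition rename cs ns : fperm A :=
  foldr (fun ca => fperm_comp (swap ca.1 ca.2)) fperm_id (zip cs ns).

Lemma rename_id cs ns a : a \notin cs -> a \notin ns -> rename cs ns a = a.
Proof.
rewrite /rename; elim: cs ns => [|c cs IH] [|n ns] //.
rewrite !inE !negb_or => /andP[ac acs] /andP[an ans].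
by rewrite [LHS]/= IH //; apply: (@swapN c n a).
Qed.

(** The head swap acts last, after the tail has sent the remaining names into [cs]. Their images
    differ from [c] by uniqueness and from [n] by disjointness, so the head swap leaves them
    alone. *)
Lemma map_rename cs ns : uniq cs -> uniq ns -> size cs = size ns ->
  (forall a, a \in cs -> a \notin ns) -> map (rename cs ns) ns = cs.
Proof.
elim: cs ns => [|c cs IH] [|n ns] //= /andP[ccs ucs] /andP[nns uns] [sz] dis.
have ncs : n \notin cs.
  apply/negP => ncs; have := dis n.
  by rewrite !inE ncs orbT eqxx => /(_ isT).
have rn a : rename (c :: cs) (n :: ns) a = swap c n (rename cs ns a) by [].
congr cons; first by rewrite [LHS](rn n) rename_id // swapR.
have {}dis a : a \in cs -> a \notin ns.
  by move=> acs; have := dis a; rewrite !inE acs orbT negb_or => /(_ isT)/andP[].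
rewrite -[RHS](IH ns ucs uns sz dis); apply/eq_in_map => a ans.
have racs : rename cs ns a \in cs by rewrite -{2}(IH ns ucs uns sz dis) map_f.
rewrite [LHS](rn a) swapN //.
  by apply: contraNneq ccs => <-.
by apply: contraNneq ncs => <-.
Qed.

Lemma fresh_fperm ns B : uniq ns ->
  exists q : fperm A, forall a, a \in ns -> q a \notin B.
Proof.
(* The targets also avoid [ns] because [map_rename] requires the two tuples to be disjoint. *)
move=> uns; pose cs := fresh_atoms (size ns) (B `|` [fset a in ns]).
have h a : a \in cs -> a \notin B `|` [fset a in ns] by exact: fresh_atoms_notin.
exists (rename cs ns) => a ans.
have : rename cs ns a \in cs.
  rewrite -[in X in _ \in X](@map_rename cs ns) ?map_f //.
  - exact: fresh_atoms_uniq.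
  - exact/eqP/size_fresh_atoms.
  by move=> b /h; rewrite !inE negb_or => /andP[].
by move/h; rewrite inE negb_or => /andP[].
Qed.

(* Going through a third tuple of atoms allows [ns] and [cs] to overlap. *)
Lemma fperm_transport ns cs B : uniq ns -> uniq cs -> size ns = size cs ->
  (forall a, a \in ns -> a \notin B) -> (forall a, a \in cs -> a \notin B) ->
  exists2 q : fperm A, map q ns = cs & {in B, q =1 id}.
Proof.
move=> uns ucs sz nsB csB.
pose C := B `|` [fset a in ns] `|` [fset a in cs].
pose es := fresh_atoms (size ns) C.
have h a : a \in es -> [&& a \notin B, a \notin ns & a \notin cs].
  by move/fresh_atoms_notin; rewrite !inE !negb_or -andbA.
have szE : size es = size ns by exact/eqP/size_fresh_atoms.
have uE : uniq es by exact: fresh_atoms_uniq.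
exists (fperm_comp (rename cs es) (rename es ns)).
  rewrite /= map_comp (@map_rename es ns) //; last by move=> a /h/and3P[].
  by rewrite map_rename // ?szE // => a acs; apply/negP => /h/and3P[_ _ /negP].
move=> a aB /=; have aes : a \notin es by apply/negP => /h/and3P[/negP].
have ans : a \notin ns by apply/negP => /nsB/negP.
have acs : a \notin cs by apply/negP => /csB/negP.
by rewrite (@rename_id es ns a) // rename_id.
Qed.

End FinitePermutations.

Section Supports.
Variables (A : atomType) (X : nominalType A).
Implicit Types (p q : fperm A) (a b c : A) (B C : {fset A}) (x : X).

Lemma eq_act p q x : p =1 q -> act p x = act q x.
Proof. by move/fperm_ext->. Qed.

Lemma act_cancel p q x : cancel p q -> act q (act p x) = x.
Proof.
by move=> pK; rewrite -act_comp -[RHS](act_id x); apply: eq_act => a /=; rewrite pK.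
Qed.

Lemma fsubset_supp B x : supports B x -> supp x `<=` B.
Proof. by move=> sB; apply/fsubsetP => a /in_supp; apply. Qed.

(** Freshness of [a] gives a support [C] without [a]. For [b] outside [B], [C] and the atoms moved
    by [p], the swap [s] of [a] and [b] fixes [x]. The conjugate of [p] by [s] fixes all of [B],
    including [a], hence fixes [x]; therefore so does [p]. *)
Lemma supportsD1 B x a : supports B x -> a # x -> supports (B `\ a) x.
Proof.
move=> sB /negP ax p pB.
have [C sC aC] : exists2 C, supports C x & a \notin C.
  apply: contrapT => h; apply: ax; apply/in_supp => C sC.
  by apply: contrapT => /negP aC; apply: h; exists C.
have [D hD] := fperm_fin p.
pose b := fresh_atom (a |` (B `|` C `|` D)).
have := fresh_atomP (a |` (B `|` C `|` D)).
rewrite -/b !inE !negb_or -!andbA => /and4P[ba bB bC bD].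
pose s := swap a b.
have sx : act s x = x.
  apply: sC => c cC; apply: swapN; first by apply: contraNneq aC => <-.
  by apply: contraNneq bC => <-.
have sps : act s (act p (act s x)) = x.
  rewrite -!act_comp; apply: sB => c cB.
  change (s (p (s c)) = c); case: (eqVneq c a) => [->|ca].
    by rewrite /s swapL hD // swapR.
  have cb : c != b by apply: contraNneq bB => <-.
  by rewrite /s swapN // pB ?swapN // !inE ca.
by rewrite -[in LHS]sx -[LHS](@act_cancel s s) ?sps //; apply: swap_funK.
Qed.

(** Starting from some finite support, the atoms outside [supp x] are deleted one at a time with
    [supportsD1], so the intersection of all supports is itself a support. *)
Lemma supports_supp x : supports (supp x) x.
Proof.
have [B sB] := finitely_supported x.
(* The list [s] holds the atoms still to be deleted; those already in [supp x] are dropped from it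
   at no cost. *)
have {B sB} [s] : exists s : seq A, supports (supp x `|` [fset a in s]) x.
  by exists B => p pB; apply: sB => a aB; apply: pB; rewrite !inE aB orbT.
elim: s => [|a s IH] h.
  by move=> p pB; apply: h => a; rewrite !inE orbF; apply: pB.
apply: IH; case: (boolP (a \in supp x)) => ax.
  move=> p pB; apply: h => b; rewrite !inE => /or3P[bx|/eqP->|bx]; apply: pB;
    by rewrite !inE ?ax ?bx ?orbT.
move=> p pB; apply: (supportsD1 h ax) => b; rewrite !inE => /andP[/negPf ->] /= bx.
by apply: pB; rewrite !inE.
Qed.

Lemma act_fix p x : {in supp x, p =1 id} -> act p x = x.
Proof. exact: supports_supp. Qed.

Lemma eq_in_act p q x : {in supp x, p =1 q} -> act p x = act q x.
Proof.
have [r [qK rK]] := fperm_inverse q.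
move=> pq; rewrite -[LHS](act_cancel _ rK); congr act; rewrite -act_comp.
by apply: act_fix => a ax /=; rewrite pq // qK.
Qed.

Lemma supports_act p B x : supports B x -> supports [fset p a | a in B] (act p x).
Proof.
have [q [pK qK]] := fperm_inverse p.
move=> sB r rB; rewrite -[RHS](act_cancel _ qK) -[LHS](act_cancel _ qK).
congr act; rewrite (act_cancel _ pK) -!act_comp; apply: sB => a aB /=.
by rewrite rB ?pK //; apply: in_imfset.
Qed.

(** Pulling supports back along the inverse gives one implication for an arbitrary permutation; the
    other is the same implication for the inverse. *)
Lemma mem_supp_act p x a : (p a \in supp (act p x)) = (a \in supp x).
Proof.
have dir (r : fperm A) (y : X) b : b \in supp y -> r b \in supp (act r y).
  move=> /in_supp h; apply/in_supp => B.
  have [q [rK qK]] := fperm_inverse r.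
  move/(@supports_act q); rewrite (act_cancel _ rK) => /h /imfsetP[c /= cB ->].
  by rewrite qK.
have [q [pK qK]] := fperm_inverse p.
apply/idP/idP; last exact: dir.
by move/(@dir q); rewrite pK (act_cancel _ pK).
Qed.

Lemma supp_actP p x b : b \in supp (act p x) -> exists2 a, a \in supp x & b = p a.
Proof.
have [q [pK qK]] := fperm_inverse p; rewrite -{1}[b]qK mem_supp_act => h.
by exists (q b); rewrite ?qK.
Qed.

Lemma fresh_renaming (ns : seq A) (xs : seq X) : uniq ns ->
  exists q : fperm A, forall a x, a \in ns -> x \in xs -> q a # x.
Proof.
case/(fresh_fperm (\bigcup_(x <- xs) supp x)) => q qP; exists q => a x /qP.
move=> /bigfcupP h xxs; apply/negP => ax.
by apply: h; exists x; rewrite ?xxs.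
Qed.

Lemma act_swap_fresh a b x : a # x -> b # x -> act (swap a b) x = x.
Proof.
move=> ax bx; apply: act_fix => c cx; apply: swapN.
  by apply: contraNneq ax => <-.
by apply: contraNneq bx => <-.
Qed.

End Supports.

(** * Simultaneous substitution *)

Lemma supp_atm (A : atomType) (U : termlikeType A) (a : A) :
  supp (atm a : U) `<=` [fset a].
Proof.
by apply: fsubset_supp => p pa; rewrite atm_equivariant pa ?inE.
Qed.

(** Viewing [U] as a sigma-algebra over itself makes the results about [sub] available for
    [tsub]. *)
Definition termlike_sigma (A : atomType) (U : termlikeType A) : sigmaType U :=
  HB.pack (Termlike.sort U) (IsSigmaAlgebra.Build A U U
    (@tsub_equivariant A U) (@tsub_id A U) (@tsub_fresh A U)
    (@tsub_alpha A U) (@tsub_sub A U)).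

Section Substitution.
Variables (A : atomType) (U : termlikeType A) (X : sigmaType U).
Implicit Types (p q : fperm A) (a b c : A) (x y : X) (u v : U).
Implicit Types (cs ns : seq A) (us : seq U).

(** Equivariance alone bounds the support by [a] together with the supports of [x] and [u]. To
    exclude [a] itself when it is fresh for [u], [sub_alpha] first renames it to a fresh [b], and
    the same bound is applied to the renamed expression. *)
Lemma supp_sub x a u : supp (sub x a u) `<=` (supp x `\ a) `|` supp u.
Proof.
have sup y b w : supp (sub y b w) `<=` b |` (supp y `|` supp w).
  apply: fsubset_supp => p h.
  rewrite sub_equivariant h ?act_fix // ?inE ?eqxx // => c hc;
    by apply: h; rewrite !inE hc !orbT.
apply/fsubsetP => c hc; rewrite !inE.
case: (boolP (c \in supp u)) => cu; first by rewrite orbT.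
rewrite orbF.
pose b := fresh_atom (c |` (a |` supp x)).
have := fresh_atomP (c |` (a |` supp x)).
rewrite -/b !inE !negb_or => /and3P[bc ba bx].
case: (eqVneq c a) => [ca|ca] /=; last first.
  by have /fsubsetP/(_ c hc) := sup x a u; rewrite !inE (negPf ca) (negPf cu) orbF.
move: hc; rewrite (@sub_alpha _ _ _ x a b u) 1?eq_sym // => /(fsubsetP (sup _ _ _)).
rewrite !inE eq_sym (negPf bc) (negPf cu) orbF /= ca.
by rewrite -{1}(swapL b a) mem_supp_act (negPf bx).
Qed.

Definition subs x cs us : X :=
  foldl (fun y cu => sub y cu.1 cu.2) x (zip cs us).

Lemma act_subs p x cs us :
  act p (subs x cs us) = subs (act p x) (map p cs) (map (act p) us).
Proof.
rewrite /subs; elim: cs us x => [|c cs IH] [|u us] x //=.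
by rewrite IH sub_equivariant.
Qed.

Lemma supp_subs x cs us b : size cs = size us -> b \in supp (subs x cs us) ->
  (b \in supp x) && (b \notin cs) \/ exists2 u, u \in us & b \in supp u.
Proof.
rewrite /subs; elim: cs us x => [|c cs IH] [|u us] x //=.
  by move=> _ ->; left.
move=> [sz] /(IH _ _ sz) [/andP[/(fsubsetP (supp_sub _ _ _))]|[v vus bv]].
  rewrite !inE => /orP[/andP[bc bx]|bu] bcs; first by left; rewrite bx negb_or bc bcs.
  by right; exists u; rewrite ?inE ?eqxx.
by right; exists v; rewrite // inE vus orbT.
Qed.

Lemma sub_subs x cs us a v : a \notin cs -> (forall c, c \in cs -> c # v) ->
  sub (subs x cs us) a v = subs (sub x a v) cs [seq tsub u a v | u <- us].
Proof.
rewrite /subs; elim: cs us x => [|c cs IH] [|u us] x //=.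
rewrite inE negb_or => /andP[ac acs] h.
rewrite IH //; last by move=> b bcs; apply: h; rewrite inE bcs orbT.
by rewrite sub_sub // 1?eq_sym // h // inE eqxx.
Qed.

Lemma subs_rename x ns us q (r : fperm A) : uniq ns -> size ns = size us ->
  {subset supp x <= ns} ->
  (forall a u, a \in ns -> u \in us -> q a # u) ->
  (forall a u, a \in ns -> u \in us -> r a # u) ->
  subs (act q x) (map q ns) us = subs (act r x) (map r ns) us.
Proof.
move=> uns sz xns qus rus; pose B := \bigcup_(u <- us) supp u.
have freshB (p : fperm A) : (forall a u, a \in ns -> u \in us -> p a # u) ->
    forall a, a \in map p ns -> a \notin B.
  move=> pus _ /mapP[a ans ->]; apply/negP => /bigfcupP[u /andP[uus _]].
  exact/negP/pus.
have [|||||s sns sB] := @fperm_transport A (map q ns) (map r ns) B.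
- by rewrite map_inj_uniq //; apply: fperm_inj.
- by rewrite map_inj_uniq //; apply: fperm_inj.
- by rewrite !size_map.
- exact: freshB.
- exact: freshB.
have supB u a : u \in us -> a \in supp u -> s a = a.
  by move=> uus au; apply: sB; apply/bigfcupP; exists u; rewrite ?uus.
have sus : map (act s) us = us.
  rewrite -[RHS]map_id; apply/eq_in_map => u uus.
  by apply: act_fix => a; apply: supB.
(* The permutations [r] and [s] after [q] agree on [ns], which contains the support of [x]. *)
have -> : act r x = act s (act q x).
  rewrite -act_comp; apply: eq_in_act => a /xns; move: a; apply/eq_in_map.
  by rewrite -sns -map_comp.
(* Every atom of [act q x] is one of the substituted names, so the result has its support within
   those of [us], where [s] is the identity. *)
rewrite -sns -[in RHS]sus -act_subs; apply/esym/act_fix => a.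
case/(supp_subs (etrans (size_map _ _) sz)) => [|[u]]; last exact: supB.
by case/andP => /supp_actP[b /xns bns ->] /negP[]; apply: map_f.
Qed.

Lemma simsubE x ns us q : uniq ns -> size ns = size us ->
  {subset supp x <= ns} -> (forall a u, a \in ns -> u \in us -> q a # u) ->
  simsub (@sub A U X) x (zip ns us) = subs (act q x) (map q ns) us.
Proof.
move=> uns sz xns qus; rewrite /simsub; set cs := fresh_atoms _ _.
rewrite unzip1_zip ?sz // unzip2_zip ?sz //.
rewrite -[foldr _ _ _]/(rename cs ns) -[foldl _ _ _]/(subs _ cs us).
(* Freshness inside [simsub] is stated over the pairs of the zipped list. Each name or term is
   located in a pair by its index; the lengths agree, so the defaults [b] and [atm b] are never
   reached. *)
have csP b : b \in cs -> b \notin ns /\ forall u, u \in us -> b # u.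
  move/fresh_atoms_notin; rewrite inE negb_or => /andP[_ /bigfcupP h].
  split=> [|u uus]; apply/negP => hb; apply: h.
    have : (nth b ns (index b ns), nth (atm b) us (index b ns)) \in zip ns us.
      rewrite -(@nth_zip _ _ b (atm b) ns us _ sz) mem_nth //.
      by rewrite size_zip sz minnn -sz index_mem.
    move=> h; exists (nth b ns (index b ns), nth (atm b) us (index b ns)).
      by rewrite h.
    by rewrite !inE nth_index // eqxx.
  have : (nth b ns (index u us), nth (atm b) us (index u us)) \in zip ns us.
    rewrite -(@nth_zip _ _ b (atm b) ns us _ sz) mem_nth //.
    by rewrite size_zip sz minnn index_mem.
  move=> h; exists (nth b ns (index u us), nth (atm b) us (index u us)).
    by rewrite h.
  by rewrite !inE nth_index // hb orbT.
have csE : map (rename cs ns) ns = cs.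
  apply: map_rename => //.
  - exact: fresh_atoms_uniq.
  - by rewrite (eqP (size_fresh_atoms _ _)) size_zip sz minnn.
  by move=> b /csP[].
rewrite -{2}csE; apply: subs_rename => // a u ans; apply: (csP _ _).2.
by rewrite -[in X in _ \in X]csE map_f.
Qed.

(** The element [x] is not permuted on the right because all its atoms are substituted away: [p]
    after [q] is again an admissible renaming, now for the permuted terms. *)
Lemma act_simsub p x ns us : uniq ns -> size ns = size us ->
  {subset supp x <= ns} ->
  act p (simsub (@sub A U X) x (zip ns us)) =
  simsub (@sub A U X) x (zip ns (map (act p) us)).
Proof.
move=> uns sz xns; have [q qus] := fresh_renaming us uns.
rewrite (simsubE uns sz xns qus) act_subs -act_comp -map_comp.
rewrite (@simsubE x ns _ (fperm_comp p q)) ?size_map //.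
by move=> a _ ans /mapP[u uus ->]; rewrite /= mem_supp_act qus.
Qed.

Lemma supp_simsub x ns us a : uniq ns -> size ns = size us ->
  {subset supp x <= ns} -> a \in supp (simsub (@sub A U X) x (zip ns us)) ->
  exists2 u, u \in us & a \in supp u.
Proof.
move=> uns sz xns; have [q qus] := fresh_renaming us uns.
rewrite (simsubE uns sz xns qus).
case/(supp_subs (etrans (size_map _ _) sz)) => // /andP[].
by case/supp_actP => b /xns bns -> /negP[]; apply: map_f.
Qed.

End Substitution.

Lemma supp_tsub (A : atomType) (U : termlikeType A) (u v : U) (a : A) :
  supp (tsub u a v) `<=` (supp u `\ a) `|` supp v.
Proof. exact: (@supp_sub _ _ (termlike_sigma U) u a v). Qed.

Section SubstitutionLemma.
Variables (A : atomType) (U : termlikeType A) (X : sigmaType U).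
Implicit Types (a : A) (x : X) (v : U) (ns : seq A) (us : seq U).

(** The renaming [q] is chosen to avoid [a] and the support of [v] as well. The outer substitution
    then passes through all the names by [sub_subs] and vanishes on the renamed [x], for which [a]
    is fresh. *)
Lemma sub_simsub x ns us a v : uniq ns -> size ns = size us ->
  {subset supp x <= ns} ->
  sub (simsub (@sub A U X) x (zip ns us)) a v =
  simsub (@sub A U X) x (zip ns [seq tsub u a v | u <- us]).
Proof.
move=> uns sz xns; pose B := a |` (supp v `|` \bigcup_(u <- us) supp u).
have [q qP] := fresh_fperm B uns.
have qns b : b \in ns -> [/\ q b != a, q b # v & forall u, u \in us -> q b # u].
  move/qP; rewrite !inE !negb_or => /and3P[-> -> /bigfcupP h]; split=> // u uus.
  by apply/negP => bu; apply: h; exists u; rewrite ?uus.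
rewrite (@simsubE _ _ X x ns us q) //; last by move=> b u /qns[_ _]; apply.
rewrite (@simsubE _ _ X x ns _ q) ?size_map //; last first.
  move=> b _ /qns[_ bv bus] /mapP[u uus ->]; apply/negP.
  move/(fsubsetP (supp_tsub u v a)).
  by rewrite !inE (negPf bv) (negPf (bus u uus)) andbF.
rewrite sub_subs.
- rewrite sub_fresh //; apply/negP => /supp_actP[b /xns/qns[+ _ _] aE].
  by rewrite -aE eqxx.
- by apply/mapP => -[b /qns[+ _ _] aE]; rewrite -aE eqxx.
by move=> _ /mapP[b /qns[_ bv _] ->].
Qed.

End SubstitutionLemma.

(** * Extension of equivariant maps on distinct atoms to arbitrary arguments *)

Section EquivariantFamilies.
Variables (A : atomType) (U : termlikeType A) (X : sigmaType U) (n : nat).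
Variable G : dtuple A n -> X.
Hypothesis G_equivariant : forall p t, act p (G t) = G (dtuple_act p t).
Implicit Types (p q : fperm A) (a : A) (t : dtuple A n) (us : 'I_n -> U).

(** Common form of [fint_ext] and [pint_ext], so that function and predicate symbols are treated
    together. *)
Definition family_ext us : X :=
  let t := fresh_dtuple n (\bigcup_(i <- enum 'I_n) supp (us i)) in
  simsub (@sub A U X) (G t) (zip (val t) [seq us i | i <- enum 'I_n]).

Lemma supp_family t : {subset supp (G t) <= val t}.
Proof.
suff /fsubset_supp/fsubsetP h : supports [fset a in tval (val t)] (G t).
  by move=> a /h; rewrite inE.
move=> p pt; rewrite G_equivariant; congr G; do 2!apply: val_inj => /=.
by rewrite -[RHS]map_id; apply/eq_in_map => a at'; apply: pt; rewrite inE.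
Qed.

Lemma size_family t us :
  size (val t) = size [seq us i | i <- enum 'I_n].
Proof. by rewrite size_map size_enum_ord size_tuple. Qed.

(** The tuple in the definition depends on [us]; freeing it lets two extensions with different
    arguments be compared over one tuple. A permutation [s] carries the chosen tuple to [t],
    equivariance of [G] carries the values along, and [q] after [s] is an admissible renaming for
    the chosen tuple. *)
Lemma family_extE us t : family_ext us =
  simsub (@sub A U X) (G t) (zip (val t) [seq us i | i <- enum 'I_n]).
Proof.
rewrite /family_ext; set t0 := fresh_dtuple _ _; set vs := map _ _.
have [|//|//|s st _] := @fperm_transport A (val t0) (val t) fset0 (valP t0) (valP t).
  by rewrite !size_tuple.
have [q qus] := fresh_renaming vs (valP t).
rewrite (@simsubE _ _ X (G t) _ _ q (valP t) (size_family t us)) //; last first.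
  exact: supp_family.
rewrite (@simsubE _ _ X (G t0) _ _ (fperm_comp q s) (valP t0)) //.
- rewrite act_comp G_equivariant /= map_comp st; congr (subs (act _ (G _)) _ _).
  exact/val_inj/val_inj.
- exact: size_family.
- exact: supp_family.
by move=> a u at0; apply: qus; rewrite -st map_f.
Qed.

Lemma act_family_ext p us :
  act p (family_ext us) = family_ext (fun i => act p (us i)).
Proof.
pose t := fresh_dtuple n (fset0 : {fset A}); rewrite !(family_extE _ t).
rewrite (act_simsub _ (valP t) (size_family t us)); last exact: supp_family.
by rewrite -map_comp.
Qed.

Lemma supp_family_ext us a :
  a \in supp (family_ext us) -> exists i, a \in supp (us i).
Proof.
pose t := fresh_dtuple n (fset0 : {fset A}); rewrite (family_extE _ t).
case/(supp_simsub (valP t) (size_family t us)); first exact: supp_family.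
by move=> u /mapP[i _ ->]; exists i.
Qed.

Lemma sub_family_ext us a v :
  sub (family_ext us) a v = family_ext (fun i => tsub (us i) a v).
Proof.
pose t := fresh_dtuple n (fset0 : {fset A}); rewrite !(family_extE _ t).
rewrite (sub_simsub _ _ (valP t) (size_family t us)); last exact: supp_family.
by rewrite -map_comp.
Qed.

End EquivariantFamilies.

(** * Fresh limits *)

Section FreshLimitTheory.
Variables (d : Order.disp_t) (A : atomType) (L : freshCompleteType d A).
Implicit Types (p q : fperm A) (B : {fset A}) (X : {fset L}) (x y z : L) (a b : A).

Lemma le_act p x y : (act p x <= act p y)%O = (x <= y)%O.
Proof.
have [q [pK _]] := fperm_inverse p.
apply/idP/idP; last exact: le_equivariant.
by move/(le_equivariant q); rewrite !(act_cancel _ pK).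
Qed.

Lemma disjoint_supp_act p B x :
  [disjoint [fset p a | a in B] & supp (act p x)] = [disjoint B & supp x].
Proof.
apply/fdisjointP/fdisjointP => h a.
  by move=> aB; rewrite -(mem_supp_act p); apply: h; apply: in_imfset.
by case/imfsetP=> b /= bB ->; rewrite mem_supp_act h.
Qed.

Lemma flim_unique B X x : is_fresh_lim B X x -> x = flim B X.
Proof.
have [lb glb] := flimP B X; case=> lb' glb'.
by apply/le_anti; rewrite glb // glb'.
Qed.

Lemma fcolim_unique B X x : is_fresh_colim B X x -> x = fcolim B X.
Proof.
have [ub lub] := fcolimP B X; case=> ub' lub'.
by apply/le_anti; rewrite lub // lub'.
Qed.

(** Lower bounds are transported along [p] and back along its inverse; uniqueness of limits then
    gives the equation. *)
Lemma act_flim p B X :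
  act p (flim B X) = flim [fset p a | a in B] [fset act p x | x in X].
Proof.
have [q [pK qK]] := fperm_inverse p; have [[dis lb] glb] := flimP B X.
apply: flim_unique; split; first split.
- by rewrite disjoint_supp_act.
- by move=> _ /imfsetP[y /= yX ->]; rewrite le_act lb.
move=> y [disy lby]; rewrite -(act_cancel y qK) le_act; apply: glb; split.
  by rewrite -(disjoint_supp_act p) (act_cancel _ qK).
by move=> x xX; rewrite -(le_act p) (act_cancel _ qK) lby // in_imfset.
Qed.

Lemma act_fcolim p B X :
  act p (fcolim B X) = fcolim [fset p a | a in B] [fset act p x | x in X].
Proof.
have [q [pK qK]] := fperm_inverse p; have [[dis ub] lub] := fcolimP B X.
apply: fcolim_unique; split; first split.
- by rewrite disjoint_supp_act.
- by move=> _ /imfsetP[y /= yX ->]; rewrite le_act ub.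
move=> y [disy uby]; rewrite -(act_cancel y qK) le_act; apply: lub; split.
  by rewrite -(disjoint_supp_act p) (act_cancel _ qK).
by move=> x xX; rewrite -(le_act p) (act_cancel _ qK) uby // in_imfset.
Qed.

Lemma act_fmeet p x y : act p (fmeet x y) = fmeet (act p x) (act p y).
Proof. by rewrite /fmeet act_flim imfset0 imfset_fset2. Qed.

Lemma act_fjoin p x y : act p (fjoin x y) = fjoin (act p x) (act p y).
Proof. by rewrite /fjoin act_fcolim imfset0 imfset_fset2. Qed.

Lemma act_fall p a x : act p (fall a x) = fall (p a) (act p x).
Proof. by rewrite /fall act_flim !imfset_fset1. Qed.

Lemma act_fbot p : act p (fbot : L) = fbot.
Proof. by rewrite /fbot act_fcolim !imfset0. Qed.

Lemma act_ftop p : act p (ftop : L) = ftop.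
Proof. by rewrite /ftop act_flim !imfset0. Qed.

(** A permutation fixing the supports of all members fixes each member, hence [X], hence the
    limit. *)
Lemma supp_flim0 X a : (forall x, x \in X -> a # x) -> a # flim fset0 X.
Proof.
move=> aX; have sup : supports (\bigcup_(x <- X) supp x) (flim fset0 X).
  move=> p h; rewrite act_flim imfset0; congr flim.
  have e x : x \in X -> act p x = x.
    move=> xX; apply: act_fix => b bx; apply: h.
    by apply/bigfcupP; exists x; rewrite ?xX.
  apply/fsetP => y; apply/imfsetP/idP => [[x /= xX ->]|yX]; first by rewrite e.
  by exists y; rewrite ?e.
apply/negP => /(fsubsetP (fsubset_supp sup)) /bigfcupP[x /andP[xX _]].
exact/negP/aX.
Qed.

Lemma supp_fcolim0 X a : (forall x, x \in X -> a # x) -> a # fcolim fset0 X.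
Proof.
move=> aX; have sup : supports (\bigcup_(x <- X) supp x) (fcolim fset0 X).
  move=> p h; rewrite act_fcolim imfset0; congr fcolim.
  have e x : x \in X -> act p x = x.
    move=> xX; apply: act_fix => b bx; apply: h.
    by apply/bigfcupP; exists x; rewrite ?xX.
  apply/fsetP => y; apply/imfsetP/idP => [[x /= xX ->]|yX]; first by rewrite e.
  by exists y; rewrite ?e.
apply/negP => /(fsubsetP (fsubset_supp sup)) /bigfcupP[x /andP[xX _]].
exact/negP/aX.
Qed.

Lemma fresh_fall a x : a # fall a x.
Proof. by have [[]] := flimP [fset a] [fset x]; rewrite fdisjoint1X. Qed.

Lemma fall_le a x : (fall a x <= x)%O.
Proof. by have [[_ h] _] := flimP [fset a] [fset x]; apply: h; rewrite inE. Qed.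

Lemma le_fall a x y : a # y -> (y <= x)%O -> (y <= fall a x)%O.
Proof.
move=> ay yx; have [_ h] := flimP [fset a] [fset x]; apply: h.
by split=> [|z]; rewrite ?fdisjoint1X // inE => /eqP->.
Qed.

Lemma supp_fall a x : supp (fall a x) `<=` supp x `\ a.
Proof.
have sup : supp (fall a x) `<=` a |` supp x.
  apply: fsubset_supp => p h.
  by rewrite act_fall h ?inE ?eqxx // act_fix // => b bx; rewrite h // !inE bx orbT.
apply/fsubsetP => b bf; move/(fsubsetP sup): (bf); rewrite !inE.
by case: eqVneq bf => // ->; rewrite (negPf (fresh_fall a x)).
Qed.

(** Both atoms are fresh for [fall a x], so the swap fixes it, while equivariance moves the swap
    inside. *)
Lemma fall_alpha a b x : b # x -> fall b (act (swap b a) x) = fall a x.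
Proof.
move=> bx; rewrite -{1}(swapR b a) -act_fall act_swap_fresh ?fresh_fall //.
by apply/negP => /(fsubsetP (supp_fall a x)); rewrite !inE (negPf bx) andbF.
Qed.

Lemma le_flim0 X z : (z <= flim fset0 X)%O <-> (forall x, x \in X -> (z <= x)%O).
Proof.
have [[_ lb] glb] := flimP fset0 X; split=> [h x xX|h].
  exact: le_trans h (lb x xX).
by apply: glb; split=> //; rewrite fdisjoint0X.
Qed.

Lemma fcolim0_le X z : (fcolim fset0 X <= z)%O <-> (forall x, x \in X -> (x <= z)%O).
Proof.
have [[_ ub] lub] := fcolimP fset0 X; split=> [h x xX|h].
  exact: le_trans (ub x xX) h.
by apply: lub; split=> //; rewrite fdisjoint0X.
Qed.

Lemma le_fmeet x y z : (z <= fmeet x y)%O = (z <= x)%O && (z <= y)%O.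
Proof.
apply/idP/andP => [/le_flim0 h|[zx zy]]; first by rewrite !h // !inE eqxx ?orbT.
by apply/le_flim0 => w; rewrite !inE => /orP[/eqP->|/eqP->].
Qed.

Lemma fjoin_le x y z : (fjoin x y <= z)%O = (x <= z)%O && (y <= z)%O.
Proof.
apply/idP/andP => [/fcolim0_le h|[zx zy]]; first by rewrite !h // !inE eqxx ?orbT.
by apply/fcolim0_le => w; rewrite !inE => /orP[/eqP->|/eqP->].
Qed.

Lemma le_ftop x : (x <= ftop)%O.
Proof. by apply/le_flim0 => y; rewrite inE. Qed.

Lemma fbot_le x : (fbot <= x)%O.
Proof. by apply/fcolim0_le => y; rewrite inE. Qed.

Lemma fmeet_leL x y : (fmeet x y <= x)%O.
Proof. by have := lexx (fmeet x y); rewrite le_fmeet => /andP[]. Qed.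

Lemma fmeet_leR x y : (fmeet x y <= y)%O.
Proof. by have := lexx (fmeet x y); rewrite le_fmeet => /andP[]. Qed.

Lemma le_fjoinL x y : (x <= fjoin x y)%O.
Proof. by have := lexx (fjoin x y); rewrite fjoin_le => /andP[]. Qed.

Lemma le_fjoinR x y : (y <= fjoin x y)%O.
Proof. by have := lexx (fjoin x y); rewrite fjoin_le => /andP[]. Qed.

Lemma fjoinC x y : fjoin x y = fjoin y x.
Proof. by rewrite /fjoin fsetUC. Qed.

(** Separates the principal formula of a sequent rule from its context. *)
Lemma flim0U1 x X : flim fset0 (x |` X) = fmeet x (flim fset0 X).
Proof.
have /le_flim0 lb := lexx (flim fset0 (x |` X)).
have /le_flim0 lbX := lexx (flim fset0 X).
apply/le_anti/andP; split.
  rewrite le_fmeet lb ?fset1U1 //=; apply/le_flim0 => y yX.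
  by apply: lb; rewrite fset1Ur.
apply/le_flim0 => y /fset1UP[->|yX]; first exact: fmeet_leL.
exact: le_trans (fmeet_leR _ _) (lbX y yX).
Qed.

Lemma fcolim0U1 x X : fcolim fset0 (x |` X) = fjoin x (fcolim fset0 X).
Proof.
have /fcolim0_le ub := lexx (fcolim fset0 (x |` X)).
have /fcolim0_le ubX := lexx (fcolim fset0 X).
apply/le_anti/andP; split; last first.
  rewrite fjoin_le ub ?fset1U1 //=; apply/fcolim0_le => y yX.
  by apply: ub; rewrite fset1Ur.
apply/fcolim0_le => y /fset1UP[->|yX]; first exact: le_fjoinL.
exact: le_trans (ubX y yX) (le_fjoinR _ _).
Qed.

End FreshLimitTheory.

(** * Complements, substitution and equality in a FOLeq algebra *)

Section FOLeqTheory.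
Variables (d : Order.disp_t) (A : atomType) (U : termlikeType A) (L : folEqType d U).
Implicit Types (p q : fperm A) (x y z m j : L) (a b : A) (u v : U).

(** The bound [j] is expanded to its join with [fmeet x (compl x)], which is bottom, and
    [fjoin_meet] distributes that join. *)
Lemma meet_compl_le m x j :
  (m <= fjoin x j)%O -> (fmeet (compl x) m <= j)%O.
Proof.
move=> h; apply: (@le_trans _ _ (fjoin j (fmeet x (compl x)))); last first.
  by rewrite fmeet_compl fjoin_le lexx fbot_le.
rewrite fjoin_meet le_fmeet (le_trans (fmeet_leL _ _) (le_fjoinR _ _)) andbT.
by apply: le_trans (fmeet_leR _ _) _; rewrite fjoinC.
Qed.

(** Distributing [fjoin (compl x) (fmeet x m)] leaves a meet of top with a join above [m]. *)
Lemma le_compl_join m x j :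
  (fmeet x m <= j)%O -> (m <= fjoin (compl x) j)%O.
Proof.
move=> h; apply: (@le_trans _ _ (fjoin (compl x) (fmeet x m))); last first.
  by rewrite fjoin_le le_fjoinL (le_trans h (le_fjoinR _ _)).
by rewrite fjoin_meet le_fmeet le_fjoinR andbT fjoinC fjoin_compl le_ftop.
Qed.

(** Equivariance of [compl] is obtained from this: the image of a complement under a permutation is
    a complement of the image. *)
Lemma compl_unique x y : fmeet x y = fbot -> fjoin x y = ftop -> y = compl x.
Proof.
move=> m j; apply/le_anti/andP; split.
  have := @le_compl_join y x fbot; rewrite m lexx => /(_ isT) h.
  by apply: le_trans h _; rewrite fjoin_le lexx fbot_le.
have := @meet_compl_le ftop x y; rewrite j lexx => /(_ isT).
by apply: le_trans; rewrite le_fmeet lexx le_ftop.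
Qed.

Lemma act_compl p x : act p (compl x) = compl (act p x).
Proof.
apply: compl_unique; first by rewrite -act_fmeet fmeet_compl act_fbot.
by rewrite -act_fjoin fjoin_compl act_ftop.
Qed.

Lemma supp_compl x : supp (compl x) `<=` supp x.
Proof.
by apply: fsubset_supp => p h; rewrite act_compl act_fix.
Qed.

Lemma supp_fmeet x y : supp (fmeet x y) `<=` supp x `|` supp y.
Proof.
apply: fsubset_supp => p h; rewrite act_fmeet !act_fix // => a ax;
  by apply: h; rewrite inE ax ?orbT.
Qed.

Lemma sub_fmeet x y a u : sub (fmeet x y) a u = fmeet (sub x a u) (sub y a u).
Proof. by rewrite sub_flim ?fdisjoint0X // imfset_fset2. Qed.

Lemma sub_fbot a u : sub (fbot : L) a u = fbot.
Proof. by rewrite sub_fcolim ?fdisjoint0X // imfset0. Qed.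

Lemma sub_fall b x a u : b != a -> b # u ->
  sub (fall b x) a u = fall b (sub x a u).
Proof.
by move=> ba bu; rewrite sub_flim ?imfset_fset1 // fdisjoint1X !inE negb_or ba.
Qed.

(** The order is expressed through binary meets, which substitution preserves. *)
Lemma le_sub x y a u : (x <= y)%O -> (sub x a u <= sub y a u)%O.
Proof.
move=> xy; have -> : x = fmeet x y.
  by apply/le_anti; rewrite le_fmeet lexx xy fmeet_leL.
by rewrite sub_fmeet fmeet_leR.
Qed.

(** Substituting for [a] is monotone and leaves [fall a x] unchanged, since [a] is fresh for it. *)
Lemma fall_le_sub a x u : (fall a x <= sub x a u)%O.
Proof.
by rewrite -[fall a x](@sub_fresh _ _ _ _ a u) ?fresh_fall // le_sub ?fall_le.
Qed.

Lemma uniq_eq_atoms : uniq [:: eq_atom1 L; eq_atom2 L].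
Proof. by rewrite /= inE eq_atom_neq. Qed.

Lemma supp_eq_atoms : {subset supp (eq_elem L) <= [:: eq_atom1 L; eq_atom2 L]}.
Proof. by move=> a /(fsubsetP (@supp_eq_elem _ _ _ L)); rewrite !inE. Qed.

Lemma act_eq_ext p u v : act p (eq_ext L u v) = eq_ext L (act p u) (act p v).
Proof.
exact: (act_simsub p (us := [:: u; v]) uniq_eq_atoms (erefl _) supp_eq_atoms).
Qed.

Lemma sub_eq_ext u v a w :
  sub (eq_ext L u v) a w = eq_ext L (tsub u a w) (tsub v a w).
Proof.
exact: (sub_simsub a w (us := [:: u; v]) uniq_eq_atoms (erefl _) supp_eq_atoms).
Qed.

Lemma supp_eq_ext u v : supp (eq_ext L u v) `<=` supp u `|` supp v.
Proof.
apply/fsubsetP => a.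
case/(supp_simsub (us := [:: u; v]) uniq_eq_atoms (erefl _) supp_eq_atoms) => w.
by rewrite !inE => /orP[/eqP->|/eqP->] ->; rewrite ?orbT.
Qed.

(* The axiom of equality speaks about substitution for the atom [eq_atom1 L]
   only; permuting it to a fresh atom [c] and renaming [a] to [c] gives the
   property for every atom [a]. *)
Lemma eq_ext_subst u v z a :
  fmeet (eq_ext L u v) (sub z a u) = fmeet (eq_ext L u v) (sub z a v).
Proof.
pose c := fresh_atom (a |` supp z); have := fresh_atomP (a |` supp z).
rewrite -/c !inE negb_or => /andP[ca cz].
rewrite !(@sub_alpha _ _ _ z a c) 1?eq_sym //.
set y := act _ z; pose s := swap (eq_atom1 L) c.
have sK (X : nominalType A) (x : X) : act s (act s x) = x.
  exact/act_cancel/swap_funK.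
have /= := @eq_elem_subst _ _ _ L (act s u) (act s v) (act s y).
rewrite -!/(eq_ext L _ _) => /(congr1 (act s)).
by rewrite !act_fmeet act_eq_ext !sub_equivariant !sK swapL.
Qed.

End FOLeqTheory.

(** * Denotations *)

Section DenotationTheory.
Variables (d : Order.disp_t) (A : atomType) (U : termlikeType A).
Variables (L : folEqType d U) (S : signature) (I : interpretation L S).
Implicit Types (p : fperm A) (a b : A) (r t : term A S) (phi psi : rpred A S).

Lemma fint_extE (f : Defs.fsym S) (us : 'I_(far f) -> U) :
  fint_ext I us = family_ext (X := termlike_sigma U) (fint I f) us.
Proof. by []. Qed.

Lemma pint_extE (P : psym S) (us : 'I_(par P) -> U) :
  pint_ext I us = family_ext (pint I P) us.
Proof. by []. Qed.

Lemma tden_act p t : tden I (tact p t) = act p (tden I t).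
Proof.
elim: t => [a|f ts IH] /=; first by rewrite atm_equivariant.
rewrite !fint_extE.
rewrite [RHS](act_family_ext (X := termlike_sigma U)
  (@fint_equivariant _ _ _ _ _ I f)).
by congr (family_ext (X := termlike_sigma U) _ _); apply/funext => i; apply: IH.
Qed.

Lemma supp_tden t : supp (tden I t) `<=` tfv t.
Proof.
elim: t => [a|f ts IH] /=; first exact: supp_atm.
rewrite fint_extE; apply/fsubsetP => a.
case/(supp_family_ext (X := termlike_sigma U) (@fint_equivariant _ _ _ _ _ I f)).
move=> i /(fsubsetP (IH i)) ai; apply/bigfcupP; exists i => //.
by rewrite mem_enum.
Qed.

Lemma tden_subst t a r : tden I (tsubst t a r) = tsub (tden I t) a (tden I r).
Proof.
elim: t => [b|f ts IH] /=.
  case: eqVneq => [->|ba]; first by rewrite tsub_atm.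
  rewrite tsub_fresh //; apply/negP => /(fsubsetP (supp_atm _ _)).
  by rewrite inE eq_sym (negPf ba).
rewrite !fint_extE.
rewrite [RHS](sub_family_ext (X := termlike_sigma U)
  (@fint_equivariant _ _ _ _ _ I f)).
by congr (family_ext (X := termlike_sigma U) _ _); apply/funext => i; apply: IH.
Qed.

Lemma rden_act p phi : rden I (ract p phi) = act p (rden I phi).
Proof.
elim: phi => [|r t|P ts|phi IH psi IH'|phi IH|a phi IH] /=.
- by rewrite act_fbot.
- by rewrite act_eq_ext !tden_act.
- rewrite !pint_extE act_family_ext; last exact: pint_equivariant.
  by congr (family_ext _ _); apply/funext => i; apply: tden_act.
- by rewrite act_fmeet IH IH'.
- by rewrite act_compl IH.
- by rewrite act_fall IH.
Qed.

(** Turns syntactic conditions on free atoms into freshness in [L]. *)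
Lemma supp_rden phi : supp (rden I phi) `<=` rfv phi.
Proof.
elim: phi => [|r t|P ts|phi IH psi IH'|phi IH|a phi IH] /=.
- by apply: fsubset_supp => p _; rewrite act_fbot.
- by apply: fsubset_trans (supp_eq_ext _ _ _) _; apply: fsetUSS; apply: supp_tden.
- apply/fsubsetP => a; rewrite pint_extE.
  case/(supp_family_ext (@pint_equivariant _ _ _ _ _ I P)).
  move=> i /(fsubsetP (supp_tden _)) ai; apply/bigfcupP; exists i => //.
  by rewrite mem_enum.
- by apply: fsubset_trans (supp_fmeet _ _) _; apply: fsetUSS.
- exact: fsubset_trans (supp_compl _) IH.
- by apply: fsubset_trans (supp_fall _ _) _; apply: fsetSD.
Qed.

Lemma rden_alpha phi psi : alpha phi psi -> rden I phi = rden I psi.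
Proof.
elim=> {phi psi} //=.
- by move=> ? ? ? _ -> _ ->.
- by move=> ? ? ? ? _ -> _ ->.
- by move=> ? ? _ ->.
- by move=> ? ? ? _ ->.
move=> a b phi bphi; rewrite rden_act fall_alpha //.
by apply: contraNN bphi => /(fsubsetP (supp_rden _)).
Qed.

(** The induction hypothesis is kept general in [p], because each binder crossed composes one more
    swap with it. *)
Lemma rden_subst_act p phi a r :
  rden I (rsubst_act p phi a r) = sub (act p (rden I phi)) a (tden I r).
Proof.
elim: phi p => [|t t'|P ts|phi IH psi IH'|phi IH|b phi IH] p /=.
- by rewrite act_fbot sub_fbot.
- by rewrite act_eq_ext sub_eq_ext !tden_subst !tden_act.
- rewrite !pint_extE act_family_ext; last exact: pint_equivariant.
  rewrite sub_family_ext; last exact: pint_equivariant.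
  by congr (family_ext _ _); apply/funext => i; rewrite tden_subst tden_act.
- by rewrite IH IH' act_fmeet sub_fmeet.
- by rewrite IH act_compl sub_compl.
set B := _ |` _; set c := fresh_atom B; have := fresh_atomP B.
rewrite -/c !inE !negb_or => /and3P[ca cr cphi].
(* By [fall_alpha] the bound atom [p b] may be renamed to [c], which differs from [a] and is fresh
   for the denotation of [r], so the substitution moves under the quantifier. *)
rewrite IH act_comp act_fall -(@fall_alpha _ _ _ (p b) c); last first.
  by rewrite -rden_act; apply: contraNN cphi => /(fsubsetP (supp_rden _)).
by rewrite sub_fall //; apply: contraNN cr => /(fsubsetP (supp_tden _)).
Qed.

Lemma den_cls phi : den I (cls phi) = rden I phi.
Proof. exact/rden_alpha/alpha_repr. Qed.

Lemma den_PBot : den I (@PBot A S) = fbot.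
Proof. exact: den_cls. Qed.

Lemma den_PEq r t : den I (PEq r t) = eq_ext L (tden I r) (tden I t).
Proof. exact: den_cls. Qed.

Lemma den_PAnd (phi psi : fpred A S) :
  den I (PAnd phi psi) = fmeet (den I phi) (den I psi).
Proof. exact: den_cls. Qed.

Lemma den_PNot (phi : fpred A S) : den I (PNot phi) = compl (den I phi).
Proof. exact: den_cls. Qed.

Lemma den_PAll a (phi : fpred A S) : den I (PAll a phi) = fall a (den I phi).
Proof. exact: den_cls. Qed.

Lemma den_psubst (phi : fpred A S) a r :
  den I (psubst phi a r) = sub (den I phi) a (tden I r).
Proof. by rewrite den_cls /rsubst rden_subst_act act_id. Qed.

Lemma not_free_fresh a (Phi : {fset fpred A S}) : not_free_in a Phi ->
  forall x, x \in [fset den I phi | phi in Phi] -> a # x.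
Proof.
move=> aPhi _ /imfsetP[phi /= phiP ->].
by apply: contraNN (aPhi phi phiP) => /(fsubsetP (supp_rden _)).
Qed.

End DenotationTheory.

(** * Soundness of the sequent rules *)

Theorem theorem5p17 (d : Order.disp_t) (A : atomType) (U : termlikeType A)
    (L : folEqType d U) (S : signature) (I : interpretation L S)
    (Phi Psi : {fset fpred A S}) :
  derivable Phi Psi ->
  (flim fset0 [fset den I phi | phi in Phi]
     <= fcolim fset0 [fset den I psi | psi in Psi])%O.
Proof.
elim=> {Phi Psi} [phi Phi Psi|Phi Psi|phi psi Phi Psi _|phi psi Phi Psi _ + _
  |phi Phi Psi _|phi Phi Psi _|a phi r Phi Psi _|a psi Phi Psi aPhi aPsi _
  |r Phi Psi _|r' r a phi Phi Psi _];
  rewrite ?imfsetU1 ?flim0U1 ?fcolim0U1.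
- exact: le_trans (fmeet_leL _ _) (le_fjoinL _ _).
- by rewrite den_PBot; apply: le_trans (fmeet_leL _ _) (fbot_le _).
- rewrite den_PAnd; apply: le_trans; rewrite !le_fmeet fmeet_leR andbT.
  rewrite (le_trans (fmeet_leL _ _) (fmeet_leL _ _)).
  exact: le_trans (fmeet_leL _ _) (fmeet_leR _ _).
(* Right conjunction: the join with the context distributes over the meet. *)
- move=> h1 h2; rewrite den_PAnd fjoinC fjoin_meet le_fmeet.
  by rewrite ![fjoin _ (den I _)]fjoinC h1.
- by rewrite den_PNot; apply: meet_compl_le.
- by rewrite den_PNot; apply: le_compl_join.
- rewrite den_PAll den_psubst; apply: le_trans; rewrite le_fmeet fmeet_leR andbT.
  exact: le_trans (fmeet_leL _ _) (fall_le_sub _ _ _).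
(* Right quantifier: freshness of [a] for the right context lets the join move under [fall], and
   freshness for the left context lets [le_fall] introduce it. *)
- move=> h; rewrite den_PAll fjoinC fjoin_fall; last first.
    exact/supp_fcolim0/not_free_fresh.
  by rewrite fjoinC; apply: le_fall h; apply/supp_flim0/not_free_fresh.
(* Right equality: the discharged hypothesis denotes top, so meeting with it costs nothing. *)
- rewrite den_PEq; apply: le_trans; rewrite le_fmeet lexx andbT.
  by rewrite [X in (_ <= X)%O](@eq_elem_refl _ _ _ L) le_ftop.
(* Left equality: the equality stays in the meet, and under it [eq_ext_subst] exchanges the two
   substitution instances. *)
rewrite den_PEq !den_psubst; apply: le_trans; rewrite le_fmeet fmeet_leL /=.
rewrite le_fmeet (le_trans (fmeet_leR _ _) (fmeet_leR _ _)) andbT.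
set e := eq_ext L _ _.
apply: (@le_trans _ _ (fmeet e (sub (den I phi) a (tden I r)))).
  by rewrite le_fmeet fmeet_leL (le_trans (fmeet_leR _ _) (fmeet_leL _ _)).
by rewrite /e -eq_ext_subst fmeet_leR.
Qed.
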